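(* Let $S=K[x_1,\ldots,x_n]$ be a polynomial ring over a field $K$, let $d>1$, and let $u,v\in S$ be monomials of degree $d$ with $u>_{lex}v$, $x_1\mid u$ and $x_1\nmid v$. Assume that the lexsegment ideal $I=(\mathcal{L}(u,v))\subseteq S$ has a linear resolution and is not a completely lexsegment ideal. Let $k\geq 1$. Then the decomposition function $g:M(I^k)\rightarrow G(I^k)$ associated to the increasing reverse lexicographical order of the generators from $G(I^k)$ is regular, that is, $\mathrm{set}(g(x_sm))\subseteq \mathrm{set}(m)$ for all $m\in G(I^k)$ and all $s\in\mathrm{set}(m)$.
   Context: $<_{lex}$ is the lexicographical order with $x_1>_{lex}\cdots>_{lex}x_n$. For monomials $u\geq_{lex}v$ of degree $d$, $\mathcal{L}(u,v)$ is the set of all monomials $w$ of degree $d$ with $u\geq_{lex}w\geq_{lex}v$; such a set is called a lexsegment set, and $(\mathcal{L}(u,v))$, the ideal it generates, a lexsegment ideal. For a set $T$ of monomials, $\mathrm{Shad}(T)=\{x_iw : 1\leq i\leq n,\ w\in T\}$ and $\mathrm{Shad}^i(T)=\mathrm{Shad}^{i-1}(\mathrm{Shad}(T))$. A lexsegment set is completely lexsegment if all its iterated shadows are again lexsegment sets; the ideal it generates is then called a completely lexsegment ideal. For a monomial $m$, $\nu_i(m)$ is the exponent of $x_i$ in $m$. For monomials of the same degree, $m_1<_{revlex}m_2$ if there is some $s$ with $\nu_i(m_1)=\nu_i(m_2)$ for all $i>s$ and $\nu_s(m_1)>\nu_s(m_2)$. For a monomial ideal $J$, $G(J)$ is its set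 of minimal monomial generators and $M(J)$ the set of all monomials in $J$. $J$ has linear quotients with respect to an ordering $m_1,\ldots,m_r$ of $G(J)$ if $(m_1,\ldots,m_{i-1}):(m_i)$ is generated by a set of variables for all $i\geq 2$; then $\mathrm{set}(m_i)=\{j : x_j\in(m_1,\ldots,m_{i-1}):(m_i)\}$ (with $\mathrm{set}(m_1)=\emptyset$), and the decomposition function $g:M(J)\to G(J)$ is defined by $g(w)=m_j$, where $j$ is the smallest index with $w\in(m_1,\ldots,m_j)$. It is known that, under the hypotheses of the claim, $I^k$ has linear quotients with respect to the increasing reverse lexicographical order of $G(I^k)$ (generators listed so that $m_1<_{revlex}m_2<_{revlex}\cdots$), for every $k\geq1$. The sets $\mathrm{set}(m)$ for $m\in G(I^k)$ and the function $g:M(I^k)\to G(I^k)$ are taken with respect to this order. *)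

(* Defs.v *)
From HB Require Import structures.
From mathcomp Require Import all_boot all_order all_algebra.
From mathcomp Require Import mpoly.

Set Implicit Arguments.
Unset Strict Implicit.
Unset Printing Implicit Defensive.

Import GRing.Theory.

Local Open Scope ring_scope.

(* The variable x_(i+1) is 'X_i for i : 'I_n.  Monomials are multi-indices
   m : 'X_{1..n}; as polynomials they are 'X_[m].  For multi-indices,
   (m1 <= m2)%MM is divisibility and (m1 + m2)%MM is the product. *)

Section Orders.

Context {n : nat}.
Implicit Types m u v w : 'X_{1..n}.

(* Both orders are only used between monomials of the same degree. *)
Definition lex_lt : rel 'X_{1..n} := fun m1 m2 =>
  [exists s : 'I_n,
    [forall i : 'I_n, (i < s)%N ==> (m1 i == m2 i)] && (m1 s < m2 s)%N].

Definition lex_le : rel 'X_{1..n} := fun m1 m2 => (m1 == m2) || lex_lt m1 m2.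

Definition revlex_lt : rel 'X_{1..n} := fun m1 m2 =>
  [exists s : 'I_n,
    [forall i : 'I_n, (s < i)%N ==> (m1 i == m2 i)] && (m2 s < m1 s)%N].

Definition lexsegment (d : nat) u v : 'X_{1..n} -> Prop :=
  fun w => [/\ mdeg w = d, lex_le w u & lex_le v w].

Definition is_lexsegment (T : 'X_{1..n} -> Prop) : Prop :=
  exists d u v, [/\ mdeg u = d, mdeg v = d, lex_le v u
                  & forall w, T w <-> lexsegment d u v w].

Definition shad (T : 'X_{1..n} -> Prop) : 'X_{1..n} -> Prop :=
  fun m => exists (i : 'I_n) w, T w /\ m = (U_(i) + w)%MM.

Definition completely_lexsegment (T : 'X_{1..n} -> Prop) : Prop :=
  forall i : nat, is_lexsegment (iter i shad T).

End Orders.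

Section Ideals.

Variables (K : fieldType) (n : nat).
Local Notation S := {mpoly K[n]}.
Implicit Types (I J : S -> Prop) (T : 'X_{1..n} -> Prop).

Definition ideal_gen (G : S -> Prop) : S -> Prop :=
  fun p => exists s : seq (S * S),
    (forall cg, cg \in s -> G cg.2) /\ p = \sum_(cg <- s) cg.1 * cg.2.

Definition monomial_ideal T : S -> Prop :=
  ideal_gen (fun p => exists2 m, T m & p = 'X_[m]).

Definition ideal_mul I J : S -> Prop :=
  ideal_gen (fun p => exists a b, [/\ I a, J b & p = a * b]).

Definition ideal_pow I (k : nat) : S -> Prop :=
  iter k (ideal_mul I) (fun _ => True).

Definition ideal_colon I J : S -> Prop :=
  fun p => forall q, J q -> I (p * q).

Definition mons J : 'X_{1..n} -> Prop := fun m => J 'X_[m].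

Definition min_gens J : 'X_{1..n} -> Prop :=
  fun m => mons J m /\ forall m', mons J m' -> (m' <= m)%MM -> m' = m.

Definition lexsegment_ideal (d : nat) (u v : 'X_{1..n}) : S -> Prop :=
  monomial_ideal (lexsegment d u v).

Definition completely_lexsegment_ideal I : Prop :=
  exists T, completely_lexsegment T /\ forall p, I p <-> monomial_ideal T p.

(* The minimal graded free resolution
     ... -> F_2 -phi 1-> F_1 -phi 0-> F_0 -eps-> I -> 0,
   with F_i the direct sum of the S(- a i j), j < b i.  Elements of F_i are row
   vectors and the maps act by right multiplication.  Homogeneity of the maps
   is read on the monomials of their entries, so an entry of phi i must vanish
   where a i.+1 j < a i l; minimality says that the entries of every phi i lie
   in the ideal (x_1, ..., x_n). *)
Definition minimal_graded_free_resolution I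
    (b : nat -> nat) (a : forall i, 'I_(b i) -> nat)
    (eps : 'cV[S]_(b 0%N)) (phi : forall i, 'M[S]_(b i.+1, b i)) : Prop :=
  [/\ (forall j, eps j 0 \is (a 0%N j).-homog),
      (forall i j l m, m \in msupp (phi i j l) ->
         (mdeg m + a i l)%N = a i.+1 j),
      (forall i j l, (phi i j l)@_0%MM = 0),
      (forall p, I p <-> exists w : 'rV[S]_(b 0%N), p = (w *m eps) 0 0)
    & (forall w : 'rV[S]_(b 0%N),
         w *m eps = 0 <-> exists w' : 'rV[S]_(b 1%N), w = w' *m phi 0%N) /\
      (forall i (w : 'rV[S]_(b i.+1)),
         w *m phi i = 0 <-> exists w' : 'rV[S]_(b i.+2), w = w' *m phi i.+1)].

Definition has_linear_resolution I : Prop :=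
  exists d b (a : forall i, 'I_(b i) -> nat) eps phi,
    minimal_graded_free_resolution I a eps phi /\
    forall i j, a i j = (d + i)%N.

Definition increasing_revlex_gens J (ms : seq 'X_{1..n}) : Prop :=
  sorted revlex_lt ms /\ forall m, m \in ms <-> min_gens J m.

Definition seq_ideal (ms : seq 'X_{1..n}) : S -> Prop :=
  monomial_ideal (fun m => m \in ms).

(* j \in set(m), for m in the list ms of generators. *)
Definition gen_set (ms : seq 'X_{1..n}) (m : 'X_{1..n}) : 'I_n -> Prop :=
  fun j => ideal_colon (seq_ideal (take (index m ms) ms))
                       (seq_ideal [:: m]) 'X_j.

(* Only the values of g on M(J) are constrained. *)
Definition decomposition_function J (ms : seq 'X_{1..n})
    (g : 'X_{1..n} -> 'X_{1..n}) : Prop :=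
  forall w, mons J w ->
    exists j, [/\ (j < size ms)%N, g w = nth 0%MM ms j,
                  seq_ideal (take j.+1 ms) 'X_[w]
                & forall i, (i < j)%N -> ~ seq_ideal (take i.+1 ms) 'X_[w]].

Definition regular_decomposition (ms : seq 'X_{1..n})
    (g : 'X_{1..n} -> 'X_{1..n}) : Prop :=
  forall m s, m \in ms -> gen_set ms m s ->
    forall j, gen_set ms (g (U_(s) + m)%MM) j -> gen_set ms m j.

End Ideals.

Arguments lexsegment_ideal K {n} d u v.
Arguments gen_set K {n} ms m.
Arguments regular_decomposition K {n} ms g.

(* Main.v *)
(* By a theorem of Aramova, De Negri and Herzog, a lexsegment ideal with linear
   resolution that is not completely lexsegment comes from
   u = x_1 x_(l+1)^a_(l+1) ... x_n^a_n and v = x_l x_n^(d-1).  Only linear first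
   syzygies are needed for this: they force, below the lcm of a generator
   divisible by x_1 and one prime to x_1, two such generators that differ in one
   variable; the pairs (x_1 x_n^(d-1), v) and (x_1 x_n^(d-1), x_l^d) pin down
   u and v.

   Write phi for the degree in x_1, ..., x_l.  All generators of I^k have
   phi >= k, and conversely for a generator m and r < j with x_r | m, the
   monomial x_j m / x_r is a generator as soon as its phi is at least k.  Hence
   set(m) consists of the j for which some r < j satisfies x_r | m and
   phi(x_j m / x_r) >= k.  If m' = g(x_s m) = x_s m / x_r with r < s, then
   phi(m') <= phi(m), so a witness t for j in set(m') is also one for m, unless
   t = s does not divide m, in which case r is. *)
Require Import Defs.
From mathcomp Require Import all_boot all_order all_algebra.
From mathcomp Require Import mpoly zify.
From Stdlib Require Import Classical.

Set Implicit Arguments.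
Unset Strict Implicit.
Unset Printing Implicit Defensive.

Import GRing.Theory.

(** * Powers and colons of monomial ideals *)

Section MonomialIdeals.

Local Open Scope ring_scope.

Variables (K : fieldType) (n : nat).
Local Notation S := {mpoly K[n]}.
Implicit Types (p q : S) (T : 'X_{1..n} -> Prop) (m t : 'X_{1..n}).

Lemma msuppM_dvd p q m : m \in msupp (p * q) ->
  exists2 t, t \in msupp q & (t <= m)%MM.
Proof.
move=> /msuppM_le /allpairsP[[a b] /= [_ bq ->]].
by exists b => //; apply: lem_addl.
Qed.

Lemma msupp_sum_mem (I : finType) (F : I -> S) m :
  m \in msupp (\sum_i F i) -> exists i, m \in msupp (F i).
Proof.
move=> /msupp_sum_le /flatten_mapP[i _ mF]; by exists i.
Qed.

Lemma ideal_gen_msupp (G : S -> Prop) p m : ideal_gen G p -> m \in msupp p ->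
  exists q t, [/\ G q, t \in msupp q & (t <= m)%MM].
Proof.
case=> s [sG ->].
move=> /msupp_sum_le /flatten_mapP[cg]; rewrite mem_filter /= => cgs.
by move=> /msuppM_dvd[t tq tm]; exists cg.2, t; split=> //; apply: sG.
Qed.

Lemma monomial_ideal_msupp T p m : monomial_ideal T p -> m \in msupp p ->
  exists2 t, T t & (t <= m)%MM.
Proof.
move=> /ideal_gen_msupp/[apply] -[q [t [[t' Tt' ->]]]].
by rewrite msuppX inE => /eqP-> ?; exists t'.
Qed.

Lemma ideal_gen_mul (G : S -> Prop) c q : G q -> ideal_gen G (c * q).
Proof.
move=> Gq; exists [:: (c, q)]; rewrite big_seq1; split=> // cg.
by rewrite inE => /eqP->.
Qed.

Lemma monomial_ideal_dvd T t m :
  T t -> (t <= m)%MM -> monomial_ideal T ('X_[m] : S).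
Proof.
by move=> Tt le_tm; rewrite -(submK le_tm) mpolyXD; apply: ideal_gen_mul; exists t.
Qed.

(** When [T] lies in a single degree, these [k]-fold products are exactly the minimal generators of
    the [k]-th power of the ideal. *)
Fixpoint mon_pow T (k : nat) : 'X_{1..n} -> Prop :=
  if k is k'.+1 then fun m => exists a b, [/\ T a, mon_pow T k' b & m = (a + b)%MM]
  else fun m => m = 0%MM.

Lemma mdeg_mon_pow d T k m : (forall t, T t -> mdeg t = d) ->
  mon_pow T k m -> mdeg m = (k * d)%N.
Proof.
move=> Td; elim: k m => [m -> | k IHk m [a [b [/Td da /IHk db ->]]]].
  by rewrite mdeg0.
by rewrite mdegD da db mulSn.
Qed.

Lemma ideal_pow_msupp T k p m :
  ideal_pow (monomial_ideal T) k p -> m \in msupp p ->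
  exists2 t, mon_pow T k t & (t <= m)%MM.
Proof.
elim: k p m => [p m _ _ | k IHk p m].
  by exists 0%MM => //; apply/mnm_lepP=> i; rewrite mnm0E.
move=> /ideal_gen_msupp/[apply] -[_ [c [[a [b [Ia Ib ->]]]]]].
move=> /msuppM_le/allpairsP[[x y] /= [xa yb ->]] le_m.
have [t Tt tx] := monomial_ideal_msupp Ia xa.
have [t' Tt' ty] := IHk _ _ Ib yb.
exists (t + t')%MM; first by exists t, t'.
apply: lepm_trans le_m; apply/mnm_lepP=> i; rewrite !mnmDE.
by rewrite leq_add //; apply/mnm_lepP.
Qed.

Lemma mons_ideal_pow T k m :
  mons (ideal_pow (monomial_ideal T : S -> Prop) k) m <->
  exists2 t, mon_pow T k t & (t <= m)%MM.
Proof.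
split=> [/ideal_pow_msupp Im|[t Tt le_tm]].
  by apply: Im; rewrite msuppX inE.
case: k Tt => [//|k] [a [b [Ta Tb tE]]]; rewrite /mons -(submK le_tm) mpolyXD.
apply: ideal_gen_mul; exists 'X_[a], 'X_[b]; split; last by rewrite tE mpolyXD.
  exact: monomial_ideal_dvd (lepm_refl _).
elim: k b Tb {tE} => [//|k IHk] _ [c [e [Tc Te ->]]].
rewrite mpolyXD -[_ * _]mul1r; apply: ideal_gen_mul.
exists 'X_[c], 'X_[e]; split=> //; last exact: IHk.
exact: monomial_ideal_dvd (lepm_refl _).
Qed.

Lemma leq_mdeg m t : (m <= t)%MM -> (mdeg m <= mdeg t)%N.
Proof. by move=> le_mt; rewrite -(submK le_mt) mdegD leq_addl. Qed.

Lemma lepm_mdeg_eq m t : (m <= t)%MM -> mdeg m = mdeg t -> m = t.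
Proof.
move=> le_mt deg_eq; rewrite -(submK le_mt).
suff /eqP-> : (t - m)%MM == 0%MM by rewrite add0m.
have := congr1 mdeg (submK le_mt); rewrite mdegD -deg_eq -mdeg_eq0.
by move/eqP; rewrite -{2}[mdeg m]add0n eqn_add2r.
Qed.

(** All [k]-fold products have degree [k * d], so none properly divides another. *)
Lemma min_gens_ideal_pow d T k m : (forall t, T t -> mdeg t = d) ->
  min_gens (ideal_pow (monomial_ideal T : S -> Prop) k) m <-> mon_pow T k m.
Proof.
move=> Td; split=> [[/mons_ideal_pow[t Tt le_tm] m_min]|Tm].
  by rewrite -(m_min t) //; apply/mons_ideal_pow; exists t => //; apply: lepm_refl.
split=> [|t /mons_ideal_pow[t' Tt' le_t't] le_tm].
  by apply/mons_ideal_pow; exists m => //; apply: lepm_refl.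
have t'm : t' = m.
  apply: lepm_mdeg_eq; first exact: lepm_trans le_tm.
  by rewrite (mdeg_mon_pow Td Tt') (mdeg_mon_pow Td Tm).
apply: lepm_mdeg_eq => //; apply/eqP; rewrite eqn_leq leq_mdeg //=.
by rewrite -t'm leq_mdeg.
Qed.

Lemma seq_idealX (ms : seq 'X_{1..n}) m :
  seq_ideal ms ('X_[m] : S) <-> exists2 t, t \in ms & (t <= m)%MM.
Proof.
split=> [/monomial_ideal_msupp ms_m|[t ms_t]].
  by apply: ms_m; rewrite msuppX inE.
exact: monomial_ideal_dvd.
Qed.

(** The colon by a principal ideal is tested on its generator [m] alone, and x_j m lies in a
    monomial ideal when a generator divides it. *)
Lemma gen_setP (ms : seq 'X_{1..n}) m j :
  gen_set K ms m j <->
  exists2 t, t \in take (index m ms) ms & (t <= U_(j) + m)%MM.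
Proof.
split=> [colon_j|[t ms_t le_t] _ [s [s_m ->]]].
  apply/seq_idealX; rewrite mpolyXD; apply: colon_j.
  by apply: monomial_ideal_dvd (lepm_refl _); rewrite inE.
have -> : \sum_(cg <- s) cg.1 * cg.2 = (\sum_(cg <- s) cg.1) * 'X_[m].
  rewrite mulr_suml; apply: eq_big_seq => cg /s_m[t'].
  by rewrite inE => /eqP-> ->.
rewrite mulrCA -mpolyXD -(submK le_t) mpolyXD mulrA.
by apply: ideal_gen_mul; exists t.
Qed.

End MonomialIdeals.

(** * Generators joined by linear syzygies *)

Section LinearSyzygies.

Local Open Scope ring_scope.

Variables (K : fieldType) (n : nat).
Local Notation S := {mpoly K[n]}.
Implicit Types (p q : S) (T : 'X_{1..n} -> Prop) (P : pred 'X_{1..n}).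

Definition mpoly_filter P p : S := \sum_(m <- msupp p | P m) p@_m *: 'X_[m].

Lemma mcoeff_filter P p m : (mpoly_filter P p)@_m = if P m then p@_m else 0.
Proof.
rewrite /mpoly_filter raddf_sum /=.
under eq_bigr do rewrite mcoeffZ mcoeffX.
have [m_p|m_p] := boolP (m \in msupp p); last first.
  rewrite (memN_msupp_eq0 m_p) if_same big_seq_cond big1 // => t /andP[t_p _].
  by case: eqP => [tm|]; rewrite ?mulr0 // -tm t_p in m_p *.
rewrite big_mkcond (bigD1_seq m) ?msupp_uniq //= eqxx mulr1 big1 ?addr0 //.
by move=> t /negPf->; rewrite mulr0 if_same.
Qed.

Lemma mpoly_filterC P p : mpoly_filter P p + mpoly_filter (predC P) p = p.
Proof.
apply/mpolyP=> m; rewrite mcoeffD !mcoeff_filter /=.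
by case: (P m); rewrite ?addr0 ?add0r.
Qed.

Lemma mem_msupp_filter P p m :
  (m \in msupp (mpoly_filter P p)) = P m && (m \in msupp p).
Proof.
by rewrite !mcoeff_msupp mcoeff_filter; case: (P m); rewrite ?eqxx.
Qed.

Lemma msupp_mulmx r c s (A : 'M[S]_(r, c)) (B : 'M[S]_(c, s)) i k m :
  m \in msupp ((A *m B) i k) -> exists j, m \in msupp (A i j * B j k).
Proof. by rewrite mxE => /msupp_sum_mem. Qed.

(* The linear functional detecting the crossing sends a row [w] of the first
   free module to the coefficient at [L] of [w *m epsP], where [epsP] keeps the
   monomials of the generators satisfying [P].  Without a crossing it kills all
   multiples of linear syzygies, yet it is 1 on the syzygy of [f] and [h]. *)
Lemma linear_resolution_crossing T d P (f h L : 'X_{1..n}) :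
  (forall m, T m -> mdeg m = d) ->
  has_linear_resolution (monomial_ideal T : S -> Prop) ->
  T f -> T h -> P f -> ~~ P h -> (f <= L)%MM -> (h <= L)%MM ->
  exists f' h' M,
    [/\ T f' /\ P f', T h' /\ ~~ P h', (M <= L)%MM & mdeg M = d.+1] /\
    (f' <= M)%MM /\ (h' <= M)%MM.
Proof.
move=> Td [d0 [b [a [eps [phi [[eps_hom phi_hom _ Igen [syz0 _]] a_lin]]]]]].
move=> Tf Th Pf Ph fL hL.
have I_eps j : monomial_ideal T (eps j 0).
  apply/Igen; exists (delta_mx 0 j); rewrite mxE (bigD1 j) //= big1 ?addr0.
    by rewrite mxE !eqxx mul1r.
  by move=> i /negPf ij; rewrite mxE ij andbF mul0r.
have eps_deg j m : m \in msupp (eps j 0) -> mdeg m = d0.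
  by move: (eps_hom j); rewrite a_lin addn0 => /dhomogP; apply.
have I_T t : T t -> monomial_ideal T ('X_[t] : S).
  by move=> Tt; apply: monomial_ideal_dvd (lepm_refl _).
(* Some monomial of an [eps j 0], of degree [d0], divides [f] and is divisible by a member of [T];
   hence d <= d0 <= d. *)
have d0E : d0 = d.
  have /Igen[w wE] := I_T _ Tf.
  have [j] : exists j, f \in msupp (w 0 j * eps j 0).
    by apply: msupp_mulmx; rewrite -wE msuppX inE.
  move=> /msuppM_dvd[m m_eps le_mf].
  have [t Tt le_tm] := monomial_ideal_msupp (I_eps j) m_eps.
  apply/eqP; rewrite eqn_leq -{1}(Td _ Tf) -(eps_deg _ _ m_eps).
  by rewrite -(Td _ Tt) !leq_mdeg.
have eps_T j m : m \in msupp (eps j 0) -> T m.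
  move=> m_eps; have [t Tt le_tm] := monomial_ideal_msupp (I_eps j) m_eps.
  by rewrite -(lepm_mdeg_eq le_tm) // (Td _ Tt) (eps_deg _ _ m_eps).
apply: NNPP => no_crossing.
pose filtered Q : 'cV[S]_(b 0%N) := \col_j mpoly_filter Q (eps j 0).
have filteredC : filtered P + filtered (predC P) = eps.
  by apply/matrixP=> j k; rewrite !mxE mpoly_filterC ord1.
have mem_filtered Q j m :
    m \in msupp (filtered Q j 0) -> [/\ Q m, T m & mdeg m = d].
  rewrite mxE mem_msupp_filter => /andP[Qm m_eps]; split=> //.
    exact: eps_T m_eps.
  by rewrite (eps_deg _ _ m_eps).
(* If no member of [T] satisfying [P] divides [M], there are no terms at all. Otherwise no member
   violating [P] divides [M], so the coefficient equals that of [phi 0 *m eps], which is zero. *)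
have phi_linear i M : (M <= L)%MM -> mdeg M = d.+1 ->
    ((phi 0%N *m filtered P) i 0)@_M = 0.
  move=> ML degM.
  have [[f' [Tf' [Pf' f'M]]]|none] :=
      classic (exists f', T f' /\ P f' /\ (f' <= M)%MM); last first.
    apply/eqP/negPn/negP; rewrite -mcoeff_msupp => /msupp_mulmx[j].
    move=> /msuppM_dvd[m /mem_filtered[Pm Tm _] mM].
    by apply: none; exists m.
  have phi_eps : phi 0%N *m eps = 0.
    apply/row_matrixP=> i'; rewrite row0 row_mul; apply/syz0.
    by exists (delta_mx 0 i'); rewrite rowE.
  have := congr1 (fun B : 'cV[S]_(b 1%N) => (B i 0)@_M) phi_eps.
  rewrite -filteredC mulmxDr [in RHS]mxE mcoeff0 mxE mcoeffD.
  rewrite [X in _ + X](_ : _ = 0) ?addr0 //.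
  apply/eqP/negPn/negP; rewrite -mcoeff_msupp => /msupp_mulmx[j].
  move=> /msuppM_dvd[m /mem_filtered[Pm Tm _] mM].
  by apply: no_crossing; exists f', m, M.
(* A nonzero coefficient at [L] needs a monomial [M] dividing [L] in an entry of
   [phi 0 *m filtered P]; linearity gives [M] degree [d.+1]. *)
have phi_killed (w : 'rV[S]_(b 1%N)) : ((w *m phi 0%N *m filtered P) 0 0)@_L = 0.
  apply/eqP/negPn/negP; rewrite -mcoeff_msupp -mulmxA => /msupp_mulmx[i].
  move=> /msuppM_dvd[M M_phi ML]; move: (M_phi).
  rewrite mcoeff_msupp phi_linear ?eqxx //.
  have [j /msuppM_le/allpairsP[[x y] /= [x_phi y_eps ->]]] := msupp_mulmx M_phi.
  have [_ _ dy] := mem_filtered _ _ _ y_eps.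
  have := phi_hom _ _ _ _ x_phi.
  by rewrite mdegD dy !a_lin d0E addn0 addn1.
have filtered0 Q t (w : 'rV[S]_(b 0%N)) :
    T t -> ~~ Q t -> ((w *m filtered Q) 0 0)@_t = 0.
  move=> Tt Qt; apply/eqP/negPn/negP; rewrite -mcoeff_msupp.
  move=> /msupp_mulmx[j /msuppM_dvd[m /mem_filtered[Qm Tm _] mt]].
  by move/negP: Qt; rewrite -(lepm_mdeg_eq mt) ?Td.
have /Igen[wf wfE] := I_T _ Tf; have /Igen[wh whE] := I_T _ Th.
have wfP : ((wf *m filtered P) 0 0)@_f = 1.
  have := congr1 (mcoeff f) wfE; rewrite -filteredC mulmxDr mxE mcoeffD.
  by rewrite mcoeffX eqxx [X in _ = _ + X]filtered0 ?addr0 //= negbK.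
(* This is the syzygy of [f] and [h]: both scaled lifts map to the monomial [L]. *)
have : ('X_[(L - f)%MM] *: wf - 'X_[(L - h)%MM] *: wh) *m eps = 0.
  apply/matrixP=> i j; rewrite !ord1 mulmxBl -!scalemxAl !mxE.
  move: wfE whE; rewrite !mxE => <- <-.
  by rewrite -!mpolyXD !submK // subrr.
move=> /syz0[w' w'E]; have := phi_killed w'; rewrite -w'E.
rewrite mulmxBl -!scalemxAl.
have entryB c c' (x y : 'rV[S]_1) :
    (c *: x - c' *: y) 0 0 = c * x 0 0 - c' * y 0 0 by rewrite !mxE.
have coeffX t (p : S) : (t <= L)%MM -> ('X_[(L - t)%MM] * p)@_L = p@_t.
  by move=> tL; rewrite mulrC -{1}(submK tL) mcoeffMX.
rewrite entryB mcoeffB !coeffX // wfP (filtered0 P h wh) // subr0.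
by move/eqP; rewrite oner_eq0.
Qed.

End LinearSyzygies.

(** * The lexicographic order *)

Section LexOrder.

Variable n : nat.
Implicit Types (a b c m u v w : 'X_{1..n.+1}) (i j s t : 'I_n.+1).

Lemma lex_ltP a b :
  reflect (exists2 s : 'I_n.+1, forall i, i < s -> a i = b i & a s < b s) (lex_lt a b).
Proof.
apply: (iffP existsP) => -[s].
  case/andP=> /forallP eq_ab lt_ab; exists s => // i lt_is.
  by apply/eqP; move: (eq_ab i); rewrite lt_is.
move=> eq_ab lt_ab; exists s; rewrite lt_ab andbT; apply/forallP=> i.
by apply/implyP=> /eq_ab ->.
Qed.

Lemma lex_lt_irr : irreflexive (@lex_lt n.+1).
Proof. by move=> a; apply/lex_ltP=> -[s _]; rewrite ltnn. Qed.

Lemma lex_lt_trans : transitive (@lex_lt n.+1).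
Proof.
move=> b a c /lex_ltP[s eq_ab lt_ab] /lex_ltP[t eq_bc lt_bc]; apply/lex_ltP.
have [lt_st|lt_ts|/val_inj eq_st] := ltngtP s t.
- exists s => [i lt_is|]; last by rewrite -eq_bc.
  by rewrite eq_ab // eq_bc // (ltn_trans lt_is).
- exists t => [i lt_it|]; last by rewrite eq_ab.
  by rewrite eq_ab ?eq_bc // (ltn_trans lt_it).
subst t; exists s => [i lt_is|]; first by rewrite eq_ab ?eq_bc.
exact: ltn_trans lt_bc.
Qed.

Lemma lex_le_refl a : lex_le a a.
Proof. by rewrite /lex_le eqxx. Qed.

Lemma lex_ltW a b : lex_lt a b -> lex_le a b.
Proof. by rewrite /lex_le orbC => ->. Qed.

Lemma lex_le_trans : transitive (@lex_le n.+1).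
Proof.
move=> b a c /predU1P[->//|lt_ab] /predU1P[<-|/(lex_lt_trans lt_ab)].
  exact: lex_ltW.
exact: lex_ltW.
Qed.

Lemma lex_le_lt_trans b a c : lex_le a b -> lex_lt b c -> lex_lt a c.
Proof. by move=> /predU1P[->//|]; apply: lex_lt_trans. Qed.

Lemma lex_leNgt a b : lex_le a b = ~~ lex_lt b a.
Proof.
apply/idP/idP=> [le_ab|nlt_ba].
  by apply/negP=> /(lex_le_lt_trans le_ab); rewrite lex_lt_irr.
rewrite /lex_le; have [//|neq_ab /=] := eqVneq a b.
have [i0 neq_i0] : exists i, a i != b i.
  apply/existsP; rewrite -negb_forall; apply: contra neq_ab => /forallP eq_ab.
  by apply/eqP/mnmP=> i; apply/eqP.
have [s neq_s min_s] := @arg_minnP _ i0 (fun i => a i != b i) val neq_i0.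
have eq_ab i : i < s -> a i = b i.
  by move=> lt_is; apply/eqP; apply: contraLR lt_is => /min_s; rewrite -leqNgt.
apply/lex_ltP; exists s => //; rewrite ltn_neqAle neq_s leqNgt.
apply: contra nlt_ba => lt_s; apply/lex_ltP; exists s => // i /eq_ab //.
Qed.

Lemma lex_ltD2l c a b : lex_lt (c + a)%MM (c + b)%MM = lex_lt a b.
Proof.
apply/lex_ltP/lex_ltP=> -[s eq_ab lt_ab]; exists s => [i /eq_ab|].
- by rewrite !mnmDE => /addnI.
- by move: lt_ab; rewrite !mnmDE ltn_add2l.
- by rewrite !mnmDE => ->.
- by rewrite !mnmDE ltn_add2l.
Qed.

Lemma lex_leD2l c a b : lex_le (c + a)%MM (c + b)%MM = lex_le a b.
Proof. by rewrite !lex_leNgt lex_ltD2l. Qed.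

Lemma lex_leU2 a i j : i <= j -> lex_le (U_(j) + a)%MM (U_(i) + a)%MM.
Proof.
rewrite leq_eqVlt => /predU1P[/val_inj->|lt_ij]; first exact: lex_le_refl.
apply/lex_ltW/lex_ltP; exists i => [s lt_si|]; rewrite !mnmDE !mnm1E.
  by rewrite -!val_eqE /= !gtn_eqF // (ltn_trans lt_si).
by rewrite eqxx -val_eqE /= gtn_eqF.
Qed.

Lemma lex_lt0 a b : a ord0 < b ord0 -> lex_lt a b.
Proof. by move=> lt0; apply/lex_ltP; exists ord0. Qed.

Lemma lex_le_prefix l a b : lex_le a b ->
  (forall i, i <= l -> b i <= a i) -> forall i, i <= l -> a i = b i.
Proof.
move=> /predU1P[->//|/lex_ltP[s eq_ab lt_ab]] le_ba i le_il; apply: eq_ab.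
apply: leq_ltn_trans le_il _; rewrite ltnNge; apply/negP=> /le_ba.
by rewrite leqNgt lt_ab.
Qed.

Lemma lex_le0 a b : lex_le a b -> a ord0 <= b ord0.
Proof. by rewrite lex_leNgt leqNgt; apply: contra; apply: lex_lt0. Qed.

(** Without such a [t], [a] would divide [b], and equal degrees would make them equal. *)
Lemma lex_lt_mdeg a b : lex_lt a b -> mdeg a = mdeg b ->
  exists s t : 'I_n.+1, [/\ s < t, forall i, i < s -> a i = b i, a s < b s & b t < a t].
Proof.
move=> /lex_ltP[s eq_ab lt_ab] deg_ab; exists s.
suff [t lt_st lt_t] : exists2 t : 'I_n.+1, s < t & b t < a t by exists t.
case: (boolP [exists t : 'I_n.+1, (s < t) && (b t < a t)]) => [/existsP[t /andP[]]|nex].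
  by exists t.
suff ab : a = b by rewrite ab ltnn in lt_ab.
apply: lepm_mdeg_eq deg_ab; apply/mnm_lepP=> i.
have [lt_is|lt_si|/val_inj->] := ltngtP i s; [by rewrite eq_ab | | exact: ltnW].
rewrite leqNgt; apply: contra nex => lt_i; apply/existsP; exists i.
by rewrite lt_si.
Qed.

Lemma lex_min m d : mdeg m = d -> lex_le (U_(ord_max) *+ d)%MM m.
Proof.
move=> deg_m; rewrite lex_leNgt; apply/negP=> /lex_lt_mdeg[].
  by rewrite mdegMn mdeg1 mul1n.
move=> s [t [lt_st _ lt_s _]]; move: lt_s.
rewrite mulmnE mnm1E; case: eqP => [eq_s|]; last by rewrite mul0n.
by move: lt_st; rewrite -eq_s ltnNge -ltnS ltn_ord.
Qed.

Lemma mnm_supp_min m : 0 < mdeg m ->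
  exists2 i, 0 < m i & forall j, j < i -> m j = 0.
Proof.
move=> m_gt0; have [i0 i0_gt0] : exists i, 0 < m i.
  apply/existsP; rewrite -[X in is_true X]negbK negb_exists.
  apply: contraL m_gt0 => /forallP m0; rewrite lt0n negbK mdeg_eq0.
  by apply/eqP/mnmP=> i; move: (m0 i); rewrite -eqn0Ngt mnm0E => /eqP.
have [i i_gt0 min_i] := @arg_minnP _ i0 (fun i => 0 < m i) val i0_gt0.
exists i => // j lt_ji; apply/eqP; rewrite eqn0Ngt.
by apply: contraL lt_ji => /min_i; rewrite -leqNgt.
Qed.

Lemma mnm_subU m i : 0 < m i -> (m = U_(i) + (m - U_(i)))%MM.
Proof. by move=> m_i; rewrite addmC submK // lep1mP -lt0n. Qed.

End LexOrder.

(** * Shadows of lexsegments *)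

Section LexsegmentShadows.

Variable n : nat.
Implicit Types (u v w m : 'X_{1..n.+1}) (T : 'X_{1..n.+1} -> Prop).

(** For [w] below [v], the monomial x_1 w may lie between the ends of the shadow although [w] is
    outside the segment. The condition recovers it as x_i times x_1 w / x_i, which is at most
    [u]. *)
Definition swap_into_segment d u v : Prop :=
  forall w, mdeg w = d -> lex_lt w v ->
    exists i : 'I_n.+1, [/\ i != ord0, 0 < w i &
      lex_le (U_(ord0) + w)%MM (U_(i) + u)%MM].

Lemma eq_shad T T' : (forall m, T m <-> T' m) -> forall m, shad T m <-> shad T' m.
Proof. by move=> TT' m; split=> -[i [w [/TT' Tw ->]]]; exists i, w. Qed.

(** For the harder inclusion: if x_1 divides [m], cancel x_1, or swap when the quotient falls below
    [v]; otherwise cancel the last variable of [m]. *)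
Lemma shad_lexsegment d u v m :
  mdeg u = d -> mdeg v = d -> 0 < u ord0 -> v ord0 = 0 ->
  swap_into_segment d u v ->
  shad (lexsegment d u v) m <->
  lexsegment d.+1 (U_(ord0) + u)%MM (U_(ord_max) + v)%MM m.
Proof.
move=> deg_u deg_v u0 v0 swap; split.
  case=> i [w [[deg_w le_wu le_vw] ->]]; split.
  - by rewrite mdegD mdeg1 deg_w.
  - apply: (@lex_le_trans _ (U_(ord0) + w)%MM); first exact: lex_leU2.
    by rewrite lex_leD2l.
  - apply: (@lex_le_trans _ (U_(i) + v)%MM); first by rewrite lex_leU2 // -ltnS.
    by rewrite lex_leD2l.
case=> deg_m le_mu le_vm.
have [m0|] := posnP (m ord0); last first.
  move=> /mnm_subU; set w := (m - _)%MM => mE.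
  have deg_w : mdeg w = d by move: deg_m; rewrite mE mdegD mdeg1 => -[].
  have le_wu : lex_le w u by move: le_mu; rewrite mE lex_leD2l.
  have [le_vw|] := boolP (lex_le v w); first by exists ord0, w.
  rewrite lex_leNgt negbK => lt_wv.
  have [i [i_neq0 w_i le_wiu]] := swap _ deg_w lt_wv.
  have w_m_i : 0 < m i by rewrite mE mnmDE addn_gt0 w_i orbT.
  exists i, (m - U_(i))%MM; rewrite -mnm_subU //; split=> //; split.
  - by move: deg_m; rewrite {1}(mnm_subU w_m_i) mdegD mdeg1 => -[].
  - by rewrite -(lex_leD2l U_(i)) -mnm_subU // mE.
  - apply/lex_ltW/lex_lt0; rewrite mnmBE mE mnmDE !mnm1E v0 eqxx.
    by rewrite (negPf i_neq0).
have [i0 i0_gt0 _] : exists2 i, 0 < m i & forall j : 'I_n.+1, j < i -> m j = 0.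
  by apply: mnm_supp_min; rewrite deg_m.
have [i m_i max_i] := @arg_maxnP _ i0 (fun i => 0 < m i) val i0_gt0.
move: (mnm_subU m_i); set w := (m - _)%MM => mE.
have deg_w : mdeg w = d by move: deg_m; rewrite mE mdegD mdeg1 => -[].
exists i, w; split=> //; split=> //.
  apply/lex_ltW/lex_lt0; move: m0; rewrite mE mnmDE => /eqP.
  by rewrite addn_eq0 => /andP[_ /eqP->].
(* If [w] were below [v], their first difference [s] would precede [i]. Multiplying [w] by x_i and
   [v] by x_n leaves the positions up to [s] untouched, so [m] would fall below x_n v. *)
rewrite lex_leNgt; apply/negP=> /lex_lt_mdeg[|s [t [lt_st eq_wv lt_s lt_t]]].
  by rewrite deg_w.
have lt_si : s < i.
  apply: leq_trans lt_st _; apply: max_i.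
  by rewrite mE mnmDE addn_gt0 (leq_trans _ lt_t) ?orbT.
have lt_sn : s < n := leq_trans lt_si (leq_ord i).
move: le_vm; rewrite lex_leNgt => /negP; apply; apply/lex_ltP; exists s.
  move=> j lt_js; rewrite mE !mnmDE eq_wv // !mnm1E.
  by rewrite -!val_eqE /= !gtn_eqF ?(ltn_trans lt_js).
by rewrite mE !mnmDE !mnm1E -!val_eqE /= !gtn_eqF.
Qed.

Lemma ord_max_neq0 v : 0 < mdeg v -> v ord0 = 0 -> ord_max != ord0 :> 'I_n.+1.
Proof.
move=> deg_v v0; apply: contraTneq deg_v => n0; rewrite mdegE big1 // => i _.
suff -> : i = ord0 by [].
by apply/val_inj/eqP; rewrite -leqn0 -[0]/(val (@ord0 n)) -n0 leq_ord.
Qed.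

(** A monomial below x_n v is prime to x_1, whereas x_1^2 divides x_1 u. Hence only the first shadow
    needs the swap as a hypothesis. *)
Lemma swap_into_segment_shad d u v :
  0 < d -> mdeg v = d -> 0 < u ord0 -> v ord0 = 0 ->
  swap_into_segment d.+1 (U_(ord0) + u)%MM (U_(ord_max) + v)%MM.
Proof.
move=> d_gt0 deg_v u0 v0 w deg_w /lex_ltW/lex_le0.
rewrite mnmDE v0 addn0 mnm1E.
rewrite (negPf (@ord_max_neq0 v _ _)) ?deg_v // leqn0 => /eqP w0.
have [i w_i _] : exists2 i, 0 < w i & forall j : 'I_n.+1, j < i -> w j = 0.
  by apply: mnm_supp_min; rewrite deg_w.
exists i; split=> //; first by apply: contraTneq w_i => ->; rewrite w0.
rewrite addmA [(U_(i) + _)%MM]addmC -addmA lex_leD2l.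
by apply/lex_ltW/lex_lt0; rewrite mnmDE w0 addn_gt0 u0 orbT.
Qed.

Lemma completely_lexsegment_swap d u v :
  0 < d -> mdeg u = d -> mdeg v = d -> 0 < u ord0 -> v ord0 = 0 ->
  swap_into_segment d u v -> completely_lexsegment (lexsegment d u v).
Proof.
move=> d_gt0 deg_u deg_v u0 v0 swap i.
suff [e [u' [v' [[e_gt0 deg_u' deg_v'] [u'0 v'0 _] segE]]]] :
    exists e u' v', [/\ [/\ 0 < e, mdeg u' = e & mdeg v' = e],
      [/\ 0 < u' ord0, v' ord0 = 0 & swap_into_segment e u' v'] &
      forall m, iter i shad (lexsegment d u v) m <-> lexsegment e u' v' m].
  by exists e, u', v'; split=> //; apply/lex_ltW/lex_lt0; rewrite v'0.
elim: i => [|i [e [u' [v' [[e_gt0 deg_u' deg_v'] [u'0 v'0 swap'] segE]]]]].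
  by exists d, u, v.
exists e.+1, (U_(ord0) + u')%MM, (U_(ord_max) + v')%MM; split.
- by rewrite !mdegD !mdeg1 deg_u' deg_v'.
- have swapS := swap_into_segment_shad e_gt0 deg_v' u'0 v'0.
  split=> //; first by rewrite mnmDE addn_gt0 u'0 orbT.
  by rewrite mnmDE v'0 mnm1E (negPf (@ord_max_neq0 v' _ _)) ?deg_v'.
move=> m /=; rewrite -shad_lexsegment //; exact: eq_shad.
Qed.

End LexsegmentShadows.

(** * Lexsegments with linear resolution *)

Section LinearLexsegments.

Variable n : nat.
Implicit Types (u v w m f : 'X_{1..n.+1}) (i j l t : 'I_n.+1).

(** This is the degree phi of the overview. *)
Definition initdeg l m : nat := \sum_(i < n.+1 | i <= l) m i.

Lemma initdegD l m f : initdeg l (m + f)%MM = initdeg l m + initdeg l f.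
Proof. by rewrite /initdeg -big_split /=; apply: eq_bigr => i _; rewrite mnmDE. Qed.

Lemma initdegU l i : initdeg l U_(i)%MM = (i <= l).
Proof.
rewrite /initdeg; under eq_bigr do rewrite mnm1E.
have [le_il|lt_li] := leqP i l.
  rewrite (bigD1 i) //= eqxx big1 // => j /andP[_ /negPf].
  by rewrite eq_sym => ->.
rewrite big1 // => j le_jl; rewrite -val_eqE /= gtn_eqF //.
exact: leq_ltn_trans lt_li.
Qed.

Lemma leq_initdeg l m i : i <= l -> m i <= initdeg l m.
Proof. by move=> le_il; rewrite /initdeg (bigD1 i) //= leq_addr. Qed.

Lemma initdeg_gt0P l m :
  reflect (exists2 i : 'I_n.+1, i <= l & 0 < m i) (0 < initdeg l m).
Proof.
apply: (iffP idP) => [|[i le_il m_i]]; last exact: leq_trans (leq_initdeg _ le_il).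
move=> gt0; case: (boolP [exists i : 'I_n.+1, (i <= l) && (0 < m i)]).
  by case/existsP=> i /andP[]; exists i.
move/existsPn=> m0; move: gt0; rewrite /initdeg big1 // => i le_il.
by move: (m0 i); rewrite le_il -eqn0Ngt => /eqP.
Qed.

(** The crossing is taken for divisibility by x_1. A multiple of [h'] of degree [d.+1] divisible by
    x_1 must be x_1 h'; and j is not the first index, since otherwise f' = h'. *)
Lemma lexsegment_crossing (K : fieldType) d u v f h :
  has_linear_resolution (lexsegment_ideal K d u v) ->
  lexsegment d u v f -> lexsegment d u v h -> 0 < f ord0 -> h ord0 = 0 ->
  exists f' h' j,
    [/\ lexsegment d u v f', lexsegment d u v h', h' ord0 = 0, j != ord0 &
        (U_(j) + f')%MM = (U_(ord0) + h')%MM] /\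
    (U_(ord0) + h' <= mlcm f h)%MM.
Proof.
move=> I_lin seg_f seg_h f0 h0.
have seg_deg m : lexsegment d u v m -> mdeg m = d by case.
have := linear_resolution_crossing (P := fun m => 0 < m ord0) seg_deg I_lin
  seg_f seg_h f0 _ (lem_mlcml f h) (lem_mlcmr f h).
rewrite h0 => /(_ isT)[f' [h' [M [crossing [le_f'M le_h'M]]]]].
have [[seg_f' f'0] [seg_h' h'0] le_ML deg_M] := crossing.
move: h'0; rewrite -eqn0Ngt => /eqP h'0.
have ME : (U_(ord0) + h')%MM = M.
  apply: lepm_mdeg_eq; last by rewrite mdegD mdeg1 (seg_deg h').
  apply/mnm_lepP=> i; rewrite mnmDE mnm1E; have [<-|_] := eqVneq.
    by rewrite h'0 addn0 (leq_trans f'0) //; apply/mnm_lepP.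
  by rewrite add0n; apply/mnm_lepP.
have /mdeg1P[j /eqP jE] : mdeg (M - f')%MM == 1.
  by rewrite -(eqn_add2r (mdeg f')) -mdegD submK // deg_M (seg_deg f').
have jE' : (U_(j) + f')%MM = (U_(ord0) + h')%MM by rewrite ME -jE submK.
exists f', h', j; split; last by rewrite ME.
split=> //; apply: contraTneq f'0 => j0.
have := congr1 (fun m : 'X_{1..n.+1} => m ord0) jE'.
by rewrite j0 !mnmDE h'0 => /addnI->.
Qed.

(* The shape [u = x_1 x_(l+1)^a_(l+1) ... x_n^a_n], [v = x_l x_n^(d-1)] of
   Aramova, De Negri and Herzog; the form of [v] enters only through the
   monomials prime to [x_1] that it bounds from below. *)
Lemma linear_noncomplete_shape (K : fieldType) d u v :
  1 < d -> mdeg u = d -> mdeg v = d -> 0 < u ord0 -> v ord0 = 0 ->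
  has_linear_resolution (lexsegment_ideal K d u v) ->
  ~ completely_lexsegment (lexsegment d u v) ->
  exists l, [/\ 0 < l, u ord0 = 1, forall i, 0 < i <= l -> u i = 0
    & forall f, mdeg f = d -> f ord0 = 0 -> lex_le v f = (0 < initdeg l f)].
Proof.
move=> d_gt1 deg_u deg_v u0 v0 I_lin ncompl.
have d_gt0 := ltnW d_gt1.
have n_neq0 : ord_max != ord0 :> 'I_n.+1.
  by apply: ord_max_neq0 v0; rewrite deg_v.
(* Since the segment is not completely lexsegment, some [w] below [v] has every swap x_1 w / x_i
   above [u]. *)
have [w [deg_w lt_wv no_swap]] : exists w, [/\ mdeg w = d, lex_lt w v &
    forall i, i != ord0 -> 0 < w i -> lex_lt (U_(i) + u)%MM (U_(ord0) + w)%MM].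
  apply: NNPP => no_w; apply: ncompl; apply: completely_lexsegment_swap => // w.
  move=> deg_w lt_wv; apply: NNPP => no_i; apply: no_w; exists w; split=> // i.
  move=> i_neq0 w_i; rewrite -[lex_lt _ _]negbK -lex_leNgt; apply/negP=> ?.
  by apply: no_i; exists i.
(* The least monomial of degree [d] divisible by x_1; taking the lcm with it affects only the
   exponents of x_1 and x_n. *)
pose x : 'X_{1..n.+1} := (U_(ord0) + U_(ord_max) *+ d.-1)%MM.
have deg_x : mdeg x = d by rewrite mdegD mdegMn !mdeg1 mul1n add1n prednK.
have x0 : x ord0 = 1 by rewrite mnmDE mulmnE !mnm1E (negPf n_neq0).
have seg_x : lexsegment d u v x.
  split=> //; last by apply/lex_ltW/lex_lt0; rewrite v0 x0.
  rewrite (mnm_subU u0) lex_leD2l lex_min //.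
  by move: deg_u; rewrite {1}(mnm_subU u0) mdegD mdeg1 => <-.
have seg_v : lexsegment d u v v.
  by split=> //; [apply/lex_ltW/lex_lt0; rewrite v0 | exact: lex_le_refl].
have lcm_x h i : i != ord0 -> i != ord_max -> mlcm x h i = h i.
  move=> /negPf i0 /negPf imax; rewrite mlcmE mnmDE mnmBE mnmDE mulmnE !mnm1E.
  by rewrite eq_sym i0 eq_sym imax subn0.
(* The crossing monomial [p] can exceed [v] only in the exponent of x_n, so v <= p and equal degrees
   force p = v. Then f = x_1 v / x_j is at most [u]. *)
have [j [j_neq0 v_j le_vj]] : exists j, [/\ j != ord0, 0 < v j &
    lex_le (U_(ord0) + v)%MM (U_(j) + u)%MM].
  have [|f [p [j [[seg_f seg_p p0 j_neq0 fpE] le_p]]]] :=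
    lexsegment_crossing I_lin seg_x seg_v _ v0; first by rewrite x0.
  have [deg_p _ le_vp] := seg_p.
  have pv : p = v.
    case/predU1P: le_vp => [//|/lex_ltP[s eq_vp lt_s]].
    have s_max : s = ord_max.
      apply: contraTeq lt_s => s_max; have [s0|s_neq0] := eqVneq s ord0.
        by rewrite s0 p0.
      rewrite -leqNgt -(lcm_x v s) //; move/mnm_lepP: le_p => /(_ s).
      by apply: leq_trans; rewrite mnmDE leq_addl.
    apply/esym/lepm_mdeg_eq; last by rewrite deg_p.
    apply/mnm_lepP=> i; have [lt_i|lt_i|/val_inj->] := ltngtP i s.
    - by rewrite eq_vp.
    - by move: lt_i; rewrite s_max ltnNge leq_ord.
    - exact: ltnW.
  have [_ le_fu _] := seg_f.
  exists j; rewrite j_neq0 -{2}pv -fpE lex_leD2l; split=> //.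
  have := congr1 (fun m : 'X_{1..n.+1} => m j) fpE.
  by rewrite pv !mnmDE !mnm1E eqxx eq_sym (negPf j_neq0) add0n => <-.
have [l v_l v_min] : exists2 i, 0 < v i & forall j : 'I_n.+1, j < i -> v j = 0.
  by apply: mnm_supp_min; rewrite deg_v.
have l_neq0 : l != ord0 by apply: contraTneq v_l => ->; rewrite v0.
have l_gt0 : 0 < l by rewrite lt0n.
have le_vl : lex_le (U_(ord0) + v)%MM (U_(l) + u)%MM.
  apply: lex_le_trans le_vj _; apply: lex_leU2; rewrite leqNgt.
  by apply: contraL v_j => /v_min->.
have [t w_t w_min] : exists2 i, 0 < w i & forall j : 'I_n.+1, j < i -> w j = 0.
  by apply: mnm_supp_min; rewrite deg_w.
have w0 : w ord0 = 0.
  by apply/eqP; rewrite -leqn0 -v0; apply/lex_le0/lex_ltW.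
have t_neq0 : t != ord0 by apply: contraTneq w_t => ->; rewrite w0.
(* If t = l, then x_1 v <= x_l u < x_1 w; if t < l, then [w] beats [v] at [t]. Both contradict w <
   v. *)
have lt_lt : l < t.
  rewrite ltnNge leq_eqVlt; apply/negP=> /predU1P[/val_inj tl|lt_tl].
    have := lex_le_lt_trans le_vl (no_swap _ _ _); rewrite -tl => /(_ t_neq0 w_t).
    rewrite lex_ltD2l => lt_vw.
    by have := lex_lt_trans lt_wv lt_vw; rewrite lex_lt_irr.
  suff lt_vw : lex_lt v w.
    by have := lex_lt_trans lt_wv lt_vw; rewrite lex_lt_irr.
  apply/lex_ltP; exists t; last by rewrite v_min.
  by move=> i lt_it; rewrite w_min // v_min // (ltn_trans lt_it).
(* In x_t u < x_1 w neither x_t nor [w] involves a variable up to [l], so [u] begins like x_1. *)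
have u_init i : i <= l -> u i = (i == ord0).
  move=> le_il; have lt_it := leq_ltn_trans le_il lt_lt.
  have := lex_le_prefix (l := l) (lex_ltW (no_swap _ t_neq0 w_t)).
  move=> /(_ _ i le_il); rewrite !mnmDE !mnm1E w_min // addn0.
  rewrite -(val_eqE t) /= (gtn_eqF lt_it) add0n eq_sym; apply=> k le_kl.
  rewrite !mnmDE !mnm1E w_min ?(leq_ltn_trans le_kl) // addn0.
  by have [<-|//] := eqVneq; rewrite addn_gt0 u0 orbT.
have u0_1 : u ord0 = 1 by rewrite u_init.
(* In the crossing for [x] and x_l^d, [f] begins like [u], so up to [l] the monomial [p] contains at
   most x_r. From v <= p follows r = l, and the lcm leaves only powers of x_n for the rest of
   [p]. *)
have le_vq : lex_le v (U_(l) + U_(ord_max) *+ d.-1)%MM.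
  pose h : 'X_{1..n.+1} := (U_(l) *+ d)%MM.
  have deg_h : mdeg h = d by rewrite mdegMn mdeg1 mul1n.
  have h0 : h ord0 = 0 by rewrite mulmnE mnm1E (negPf l_neq0).
  have seg_h : lexsegment d u v h.
    split=> //; first by apply/lex_ltW/lex_lt0; rewrite h0.
    rewrite lex_leNgt; apply/negP=> /lex_lt_mdeg[|s [r [lt_sr eq_hv lt_s lt_r]]].
      by rewrite deg_h.
    have rl : r = l.
      apply: contraTeq lt_r => /negPf rl.
      by rewrite mulmnE mnm1E eq_sym rl mul0n.
    by move: lt_s; rewrite v_min // -rl.
  have [|f [p [r [[seg_f seg_p p0 r_neq0 fpE] le_p]]]] :=
    lexsegment_crossing I_lin seg_x seg_h _ h0; first by rewrite x0.
  have [_ le_fu _] := seg_f; have [deg_p _ le_vp] := seg_p.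
  have eq_at i : (r == i) + f i = (ord0 == i) + p i.
    have := congr1 (fun m : 'X_{1..n.+1} => m i) fpE.
    by rewrite !mnmDE !mnm1E.
  have f0 : f ord0 = 1 by move: (eq_at ord0); rewrite (negPf r_neq0) p0.
  have f_init i : i <= l -> f i = (i == ord0).
    move=> le_il; rewrite -u_init //; apply: lex_le_prefix le_il => // k le_kl.
    by rewrite u_init //; have [->|//] := eqVneq; rewrite f0.
  have p_init i : i <= l -> p i = (r == i).
    by move=> le_il; have := eq_at i; rewrite f_init // (eq_sym i) addnC => /addnI.
  have lt_l_max : l < n := leq_trans lt_lt (leq_ord t).
  have p_dvd i : i != ord_max -> i != l -> p i = 0.
    have [->|i_neq0 i_max il] := eqVneq i ord0; first by rewrite p0.
    apply/eqP; rewrite -leqn0 (_ : 0 = h i).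
      rewrite -(lcm_x h i) //; move/mnm_lepP: le_p => /(_ i).
      by apply: leq_trans; rewrite mnmDE leq_addl.
    by rewrite mulmnE mnm1E eq_sym (negPf il).
  have rl : r = l.
    apply: contraTeq le_vp => rl; rewrite lex_leNgt negbK; apply/lex_ltP.
    exists l => [i lt_il|]; last by rewrite p_init // (negPf rl).
    rewrite v_min // p_dvd // -val_eqE /= ltn_eqF //.
    exact: ltn_trans lt_l_max.
  suff <- : p = (U_(l) + U_(ord_max) *+ d.-1)%MM by [].
  apply: lepm_mdeg_eq; last by rewrite deg_p mdegD mdegMn !mdeg1 mul1n add1n prednK.
  apply/mnm_lepP=> i; rewrite mnmDE mulmnE !mnm1E.
  have [->|i_max] := eqVneq i ord_max.
    move/mnm_lepP: le_p => /(_ ord_max); rewrite mlcmE !mnmDE mnmBE !mnmDE.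
    rewrite !mulmnE !mnm1E eqxx (eq_sym ord0) (negPf n_neq0).
    by rewrite -(val_eqE l) /= (ltn_eqF lt_l_max) sub0n !add0n addn0.
  have [->|il] := eqVneq i l; last by rewrite p_dvd.
  by rewrite p_init // rl eqxx.
exists l; split=> // [i /andP[i_gt0 le_il]|f deg_f f0].
  by rewrite u_init // -val_eqE /= gtn_eqF.
apply/idP/initdeg_gt0P=> [le_vf|[i le_il f_i]].
  apply: NNPP => f_init; move: le_vf; rewrite lex_leNgt => /negP; apply.
  have f_l i : i <= l -> f i = 0.
    move=> le_il; apply/eqP; rewrite eqn0Ngt; apply/negP=> f_i.
    by apply: f_init; exists i.
  apply/lex_ltP; exists l => [i lt_il|]; last by rewrite f_l.
  by rewrite f_l ?v_min // ltnW.
(* Here f >= x_i x_n^(d-1) >= x_l x_n^(d-1) >= v. *)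
apply: lex_le_trans le_vq _.
apply: (@lex_le_trans _ (U_(i) + U_(ord_max) *+ d.-1)%MM); first exact: lex_leU2.
rewrite (mnm_subU f_i) lex_leD2l lex_min //.
by move: deg_f; rewrite {1}(mnm_subU f_i) mdegD mdeg1 => <-.
Qed.

End LinearLexsegments.

(** * Exchange of variables in powers *)

Section Exchange.

Variable n : nat.
Implicit Types (u v m f g : 'X_{1..n.+1}) (i j l r t : 'I_n.+1).
Implicit Types (T : 'X_{1..n.+1} -> Prop).

Lemma addmCA m f g : (m + (f + g) = f + (m + g))%MM.
Proof. by rewrite !addmA (addmC m). Qed.

(* [x_j m / x_r] lies in [T], stated without truncated subtraction. *)
Definition replaceable T r j m : Prop :=
  exists2 m', T m' & (U_(r) + m' = U_(j) + m)%MM.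

Lemma mon_pow_replaceable T k r j m :
  (forall f, T f -> 0 < f r -> replaceable T r j f) ->
  mon_pow T k m -> 0 < m r -> replaceable (mon_pow T k) r j m.
Proof.
move=> T_rep; elim: k m => [m ->|k IHk m [a [b [Ta Tb ->]]]]; first by rewrite mnm0E.
rewrite mnmDE addn_gt0 => /orP[/(T_rep _ Ta)[a' Ta' aE]|/(IHk _ Tb)[b' Tb' bE]].
  by exists (a' + b)%MM; [exists a', b | rewrite !addmA aE].
exists (a + b')%MM; first by exists a, b'.
by rewrite addmCA bE addmCA.
Qed.

Lemma initdeg_mon_pow T l k m :
  (forall f, T f -> 0 < initdeg l f) -> mon_pow T k m -> k <= initdeg l m.
Proof.
move=> T_init; elim: k m => [//|k IHk m [a [b [/T_init a_gt0 /IHk b_ge ->]]]].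
by rewrite initdegD -add1n leq_add.
Qed.

(** By the pigeonhole principle some factor has phi at least 2, and the exchange is made in that
    factor. *)
Lemma mon_pow_excess T l j k m :
  (forall f, T f -> 1 < initdeg l f ->
     exists t, [/\ 0 < t <= l, 0 < f t & replaceable T t j f]) ->
  mon_pow T k m -> k < initdeg l m ->
  exists t, [/\ 0 < t <= l, 0 < m t & replaceable (mon_pow T k) t j m].
Proof.
move=> T_exc; elim: k m => [m ->|k IHk m [a [b [Ta Tb ->]]]].
  by move/initdeg_gt0P=> [i _]; rewrite mnm0E.
rewrite initdegD; have [/(T_exc _ Ta)[t [tl a_t [a' Ta' aE]]] _|a_le lt_k] :=
  ltnP 1 (initdeg l a).
  exists t; split=> //; first by rewrite mnmDE addn_gt0 a_t.
  by exists (a' + b)%MM; [exists a', b | rewrite !addmA aE].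
have [|t [tl b_t [b' Tb' bE]]] := IHk _ Tb.
  by rewrite -ltnS (leq_trans lt_k) // -add1n leq_add2r.
exists t; split=> //; first by rewrite mnmDE addn_gt0 b_t orbT.
by exists (a + b')%MM; [exists a, b' | rewrite addmCA bE addmCA].
Qed.

(** The numerical hypothesis is phi(x_j m / x_r) >= k without subtraction. If [r] and [j] lie on the
    same side of [l], one factor suffices; the case r <= l < j takes up to two exchanges. *)
Lemma mon_pow_exchange T l k r j m :
  (forall f r t, T f -> r <= l -> 0 < t <= l -> 0 < f r -> replaceable T r t f) ->
  (forall f r j, T f -> l < r < j -> 0 < f r -> replaceable T r j f) ->
  (forall f j, T f -> l < j -> 1 < initdeg l f ->
     exists t, [/\ 0 < t <= l, 0 < f t & replaceable T t j f]) ->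
  mon_pow T k m -> r < j -> 0 < m r -> k + (r <= l) <= initdeg l m + (j <= l) ->
  replaceable (mon_pow T k) r j m.
Proof.
move=> T_low T_high T_exc Tm lt_rj m_r.
have [le_jl _|lt_lj] := leqP j l.
  have le_rl : r <= l := ltnW (leq_trans lt_rj le_jl).
  apply: mon_pow_replaceable Tm m_r => f Tf f_r.
  by apply: T_low; rewrite // le_jl (leq_ltn_trans _ lt_rj).
have [le_rl|lt_lr _] := leqP r l; last first.
  apply: mon_pow_replaceable Tm m_r => f Tf f_r.
  by apply: T_high; rewrite // lt_lr.
rewrite addn1 addn0 => lt_k.
(* A factor with excess gives up a low x_t for x_j; afterwards x_r is traded for x_t, so that the
   net effect replaces x_r by x_j. *)
have [|t [tl m_t [m' Tm' m'E]]] := mon_pow_excess (j := j) _ Tm lt_k.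
  by move=> f Tf; apply: T_exc.
have [<-|tr] := eqVneq t r; first by exists m'.
have m'_r : 0 < m' r.
  have := congr1 (fun m : 'X_{1..n.+1} => m r) m'E.
  by rewrite !mnmDE !mnm1E (negPf tr) add0n => ->; rewrite addn_gt0 m_r orbT.
have [m'' Tm'' m''E] := mon_pow_replaceable (r := r) (j := t)
  (fun f Tf => T_low f r t Tf le_rl tl) Tm' m'_r.
by exists m''; rewrite // m''E m'E.
Qed.

(** * Exchange properties of the generators of the lexsegment ideal *)

Section Segment.

Variables (d : nat) (u v : 'X_{1..n.+1}) (l : 'I_n.+1).
Hypotheses (u0 : u ord0 = 1) (l_gt0 : 0 < l) (v0 : v ord0 = 0).
Hypothesis u_init : forall i, 0 < i <= l -> u i = 0.
Hypothesis v_min : forall f, mdeg f = d -> f ord0 = 0 ->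
  lex_le v f = (0 < initdeg l f).

(** A member divisible by x_1 is at most [u], hence has the exponents of [u] up to [l]: x_1 and
    nothing else. *)
Lemma segment_shapeP f :
  lexsegment d u v f <-> mdeg f = d /\
    (f ord0 = 0 /\ 0 < initdeg l f \/
     [/\ f ord0 = 1, initdeg l f = 1 & lex_le f u]).
Proof.
split=> [[deg_f le_fu le_vf]|[deg_f [[f0 f_init]|[f0 _ le_fu]]]]; last first.
- by split=> //; apply/lex_ltW/lex_lt0; rewrite v0 f0.
- split; rewrite ?v_min //.
  by apply/lex_ltW/lex_lt0; rewrite u0 f0.
split=> //; have := lex_le0 le_fu; rewrite u0.
case f0E: (f ord0) => [|[|//]] _; first by left; rewrite -v_min.
right; split=> //; rewrite /initdeg (bigD1 ord0) //= f0E big1 ?addn0 // => i.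
move=> /andP[le_il i_neq0].
rewrite (lex_le_prefix le_fu _ le_il) ?u_init ?le_il ?lt0n ?andbT //.
move=> j le_jl; have [->|j_neq0] := eqVneq j ord0; first by rewrite u0 f0E.
by rewrite u_init // le_jl andbT lt0n.
Qed.

(** If x_1 divides [f], then phi(f) = 1 forces x_r = x_1. So removing x_r always leaves a monomial
    prime to x_1, and x_t makes phi positive. *)
Lemma segment_low f r t : lexsegment d u v f -> r <= l -> 0 < t <= l -> 0 < f r ->
  replaceable (lexsegment d u v) r t f.
Proof.
move=> /segment_shapeP[deg_f shape_f] le_rl /andP[t_gt0 le_tl] f_r.
have t_neq0 : t != ord0 by rewrite -lt0n.
have := mnm_subU f_r; set g := (f - _)%MM => fE.
have init_f : initdeg l f = (initdeg l g).+1 by rewrite fE initdegD initdegU le_rl.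
exists (U_(t) + g)%MM; last by rewrite fE addmCA.
apply/segment_shapeP; split; first by rewrite -deg_f fE !mdegD !mdeg1.
left; rewrite initdegD initdegU le_tl; split=> //.
rewrite mnmDE mnm1E (negPf t_neq0); apply/eqP; rewrite -leqn0 add0n.
case: shape_f => [[<- _]|[_ init1 _]]; first by rewrite fE mnmDE leq_addl.
move: init1; rewrite init_f => -[<-]; exact: leq_initdeg.
Qed.

Lemma segment_high f r j : lexsegment d u v f -> l < r < j -> 0 < f r ->
  replaceable (lexsegment d u v) r j f.
Proof.
move=> /segment_shapeP[deg_f shape_f] /andP[lt_lr lt_rj] f_r.
have := mnm_subU f_r; set g := (f - _)%MM => fE.
have lt_lj := ltn_trans lt_lr lt_rj.
exists (U_(j) + g)%MM; last by rewrite fE addmCA.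
have le_f : lex_le (U_(j) + g)%MM f by rewrite fE; apply/lex_leU2/ltnW.
have eq0 : (U_(j) + g)%MM ord0 = f ord0.
  rewrite fE !mnmDE !mnm1E -!val_eqE /= !gtn_eqF //.
    exact: ltn_trans lt_lr.
  exact: ltn_trans lt_lj.
have eq_init : initdeg l (U_(j) + g)%MM = initdeg l f.
  by rewrite fE !initdegD !initdegU (leqNgt r) (leqNgt j) lt_lr lt_lj.
apply/segment_shapeP; split; first by rewrite -deg_f fE !mdegD !mdeg1.
rewrite eq0 eq_init; case: shape_f => [|[f0 init_f le_fu]]; [by left | right].
by split=> //; apply: lex_le_trans le_fu.
Qed.

(** The bound on phi excludes that x_1 divides [f]; any low variable may then be given up, and phi
    stays positive. *)
Lemma segment_excess f j : lexsegment d u v f -> l < j -> 1 < initdeg l f ->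
  exists t, [/\ 0 < t <= l, 0 < f t & replaceable (lexsegment d u v) t j f].
Proof.
move=> /segment_shapeP[deg_f shape_f] lt_lj init_f.
have f0 : f ord0 = 0 by case: shape_f init_f => [[]//|[_ ->]].
have [t le_tl f_t] := initdeg_gt0P _ _ (ltnW init_f).
have t_neq0 : t != ord0 by apply: contraTneq f_t => ->; rewrite f0.
exists t; rewrite le_tl andbT; split=> //; first by rewrite lt0n.
have := mnm_subU f_t; set g := (f - _)%MM => fE.
exists (U_(j) + g)%MM; last by rewrite fE addmCA.
apply/segment_shapeP; split; first by rewrite -deg_f fE !mdegD !mdeg1.
left; move: init_f f0; rewrite fE !initdegD !initdegU !mnmDE !mnm1E le_tl.
rewrite (leqNgt j) lt_lj (negPf t_neq0) add0n => init_g ->; split=> //.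
by rewrite -val_eqE /= gtn_eqF // (ltn_trans l_gt0).
Qed.

End Segment.

End Exchange.

(** * Reverse lexicographic order and decomposition functions *)

Section Revlex.

Variable n : nat.
Implicit Types (m t : 'X_{1..n}) (i j r s : 'I_n) (ms : seq 'X_{1..n}).

Lemma revlex_ltP m t :
  reflect (exists2 s : 'I_n, forall i, s < i -> m i = t i & t s < m s)
          (revlex_lt m t).
Proof.
apply: (iffP existsP) => -[s].
  case/andP=> /forallP eq_mt lt_s; exists s => // i lt_si.
  by apply/eqP; move: (eq_mt i); rewrite lt_si.
move=> eq_mt lt_s; exists s; rewrite lt_s andbT; apply/forallP=> i.
by apply/implyP=> /eq_mt ->.
Qed.

Lemma revlex_lt_irr : irreflexive (@revlex_lt n).
Proof. by move=> m; apply/revlex_ltP=> -[s _]; rewrite ltnn. Qed.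

Lemma revlex_lt_trans : transitive (@revlex_lt n).
Proof.
move=> b a c /revlex_ltP[s eq_ab lt_ab] /revlex_ltP[t eq_bc lt_bc]; apply/revlex_ltP.
have [lt_st|lt_ts|/val_inj eq_st] := ltngtP s t.
- exists t => [i lt_ti|]; last by rewrite eq_ab.
  by rewrite eq_ab ?eq_bc // (ltn_trans lt_st).
- exists s => [i lt_si|]; last by rewrite -eq_bc.
  by rewrite eq_ab // eq_bc // (ltn_trans lt_ts).
subst t; exists s => [i lt_is|]; first by rewrite eq_ab ?eq_bc.
exact: ltn_trans lt_ab.
Qed.

Lemma revlex_lt_swap r j m t :
  (U_(r) + t = U_(j) + m)%MM -> r < j -> revlex_lt t m.
Proof.
move=> tE lt_rj; have eq_at i : (r == i) + t i = (j == i) + m i.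
  by have := congr1 (fun m : 'X_{1..n} => m i) tE; rewrite !mnmDE !mnm1E.
apply/revlex_ltP; exists j => [i lt_ji|].
  have := eq_at i; rewrite -!val_eqE /= !ltn_eqF //.
  exact: ltn_trans lt_ji.
by have := eq_at j; rewrite eqxx -val_eqE /= ltn_eqF // add0n => ->.
Qed.

(** By degrees x_j m / t is a variable x_r; r > j would put [t] after [m], and r = j would give t =
    m. *)
Lemma revlex_lt_dvd j m t :
  mdeg t = mdeg m -> revlex_lt t m -> (t <= U_(j) + m)%MM ->
  exists r : 'I_n, [/\ r < j, 0 < m r & (U_(r) + t = U_(j) + m)%MM].
Proof.
move=> deg_t lt_tm le_t; have /mdeg1P[r /eqP rE] : mdeg (U_(j) + m - t)%MM == 1.
  by rewrite -(eqn_add2r (mdeg t)) -mdegD submK // mdegD mdeg1 deg_t.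
have tE : (U_(r) + t = U_(j) + m)%MM by rewrite -rE submK.
have [lt_rj|lt_jr|/val_inj eq_rj] := ltngtP r j.
- exists r; split=> //; have := congr1 (fun m : 'X_{1..n} => m r) tE.
  by rewrite !mnmDE !mnm1E eqxx -(val_eqE j) /= gtn_eqF // add0n => <-.
- have := revlex_lt_trans lt_tm (revlex_lt_swap (esym tE) lt_jr).
  by rewrite revlex_lt_irr.
by move: lt_tm; rewrite eq_rj in tE; rewrite (addmI tE) revlex_lt_irr.
Qed.

Lemma mem_take_revlex ms m t : sorted revlex_lt ms -> m \in ms ->
  (t \in take (index m ms) ms) = (t \in ms) && revlex_lt t m.
Proof.
move=> ms_sorted ms_m; have [ms_t|ms_t] := boolP (t \in ms); last first.
  by apply: contraNF ms_t => /mem_take.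
rewrite in_take //=; apply/idP/idP=> [|lt_tm].
  exact: (sorted_ltn_index revlex_lt_trans ms_sorted).
rewrite ltnNge leq_eqVlt; apply/negP=> /predU1P[eq_idx|].
  by move: lt_tm; rewrite (index_inj m ms_m ms_t eq_idx) revlex_lt_irr.
move/(sorted_ltn_index revlex_lt_trans ms_sorted _ _ ms_m ms_t).
by move/(revlex_lt_trans lt_tm); rewrite revlex_lt_irr.
Qed.

(** Minimality of the index makes [g w] the first generator dividing [w], so it comes no later than
    [t]. *)
Lemma decomposition_function_take (K : fieldType) (J : {mpoly K[n]} -> Prop)
    ms g w m t :
  decomposition_function J ms g -> mons J w -> m \in ms ->
  t \in take (index m ms) ms -> (t <= w)%MM ->
  g w \in take (index m ms) ms /\ (g w <= w)%MM.
Proof.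
move=> g_decomp Jw ms_m take_t le_tw.
have [j [lt_j gwE /seq_idealX[a take_a le_aw] j_min]] := g_decomp _ Jw.
have ms_t : t \in ms := mem_take take_t.
have lt_tm : index t ms < index m ms by rewrite -in_take.
have le_jt : j <= index t ms.
  rewrite leqNgt; apply/negP=> /j_min; apply; apply/seq_idealX; exists t => //.
  by rewrite in_take ?ltnSn.
have ms_a : a \in ms := mem_take take_a.
have -> : g w = a.
  rewrite gwE; suff -> : j = index a ms by rewrite nth_index.
  apply/eqP; rewrite eqn_leq -[index a ms <= j]ltnS -in_take // take_a andbT leqNgt.
  apply/negP=> /j_min; apply; apply/seq_idealX; exists a => //.
  by rewrite in_take ?ltnSn.
split=> //; rewrite in_take // (leq_trans _ lt_tm) // ltnS.
by apply: leq_trans le_jt; rewrite -ltnS -in_take.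
Qed.

End Revlex.

(** * Regularity of the decomposition function *)

Theorem theorem2p12 (K : fieldType) (n d : nat) (u v : 'X_{1..n.+1})
    (d_gt1 : 1 < d) (deg_u : mdeg u = d) (deg_v : mdeg v = d)
    (v_lt_u : lex_lt v u)
    (x1_dvd_u : (U_(ord0) <= u)%MM) (x1_ndvd_v : ~~ (U_(ord0) <= v)%MM)
    (I_lin : has_linear_resolution (lexsegment_ideal K d u v))
    (I_ncompl : ~ completely_lexsegment_ideal (lexsegment_ideal K d u v))
    (k : nat) (k_gt0 : 0 < k)
    (ms : seq 'X_{1..n.+1})
    (ms_gens : increasing_revlex_gens
                 (ideal_pow (lexsegment_ideal K d u v) k) ms)
    (g : 'X_{1..n.+1} -> 'X_{1..n.+1})
    (g_decomp : decomposition_function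
                  (ideal_pow (lexsegment_ideal K d u v) k) ms g) :
  regular_decomposition K ms g.
Proof.
have u0 : 0 < u ord0 by rewrite lt0n -lep1mP.
have v0 : v ord0 = 0 by move: x1_ndvd_v; rewrite lep1mP negbK => /eqP.
have seg_ncompl : ~ completely_lexsegment (lexsegment d u v).
  by move=> seg_compl; apply: I_ncompl; exists (lexsegment d u v).
have [l [l_gt0 u0_1 u_init v_min]] :=
  linear_noncomplete_shape d_gt1 deg_u deg_v u0 v0 I_lin seg_ncompl.
have seg_deg f : lexsegment d u v f -> mdeg f = d by case.
have [ms_sorted ms_min] := ms_gens.
have mem_ms m : m \in ms <-> mon_pow (lexsegment d u v) k m.
  by rewrite ms_min; apply: min_gens_ideal_pow seg_deg.
have ms_deg m : m \in ms -> mdeg m = (k * d)%N.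
  by move/mem_ms; apply: mdeg_mon_pow.
have seg_init f : lexsegment d u v f -> 0 < initdeg l f.
  by move/(segment_shapeP u0_1 v0 u_init v_min) => [_ [[]|[_ ->]]].
have exchange m (r j : 'I_n.+1) : m \in ms -> r < j -> 0 < m r ->
    k + (r <= l) <= initdeg l m + (j <= l) -> gen_set K ms m j.
  move=> ms_m lt_rj m_r k_le; have [||||m' Tm' m'E] :=
    mon_pow_exchange (T := lexsegment d u v) (l := l) _ _ _ _ lt_rj m_r k_le.
  - by move=> f p t; apply: (segment_low u0_1 v0 u_init v_min).
  - by move=> f p t; apply: (segment_high u0_1 l_gt0 v0 u_init v_min).
  - by move=> f t; apply: (segment_excess u0_1 l_gt0 v0 u_init v_min).
  - exact/mem_ms.
  apply/gen_setP; exists m'; last by rewrite -m'E lem_addl.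
  by rewrite mem_take_revlex // (revlex_lt_swap m'E) // andbT; apply/mem_ms.
have gen_set_swap m (j : 'I_n.+1) : m \in ms -> gen_set K ms m j ->
    exists r : 'I_n.+1, [/\ r < j, 0 < m r &
      k + (r <= l) <= initdeg l m + (j <= l)].
  move=> ms_m /gen_setP[t]; rewrite mem_take_revlex // => /andP[ms_t lt_tm] le_t.
  have [|r [lt_rj m_r tE]] := revlex_lt_dvd _ lt_tm le_t; first by rewrite !ms_deg.
  (* Evaluate phi on x_r t = x_j m; as a product of [k] generators, [t] has phi at least [k]. *)
  exists r; split=> //; have := congr1 (initdeg l) tE.
  rewrite !initdegD !initdegU [in RHS]addnC => <-.
  by rewrite addnC leq_add2l; apply: (initdeg_mon_pow seg_init); apply/mem_ms.
move=> m s ms_m /gen_setP[t take_t le_t] j.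
have w_mons : mons (ideal_pow (lexsegment_ideal K d u v) k) (U_(s) + m)%MM.
  apply/mons_ideal_pow; exists m; last exact: lem_addl.
  exact/mem_ms.
have [] := decomposition_function_take g_decomp w_mons ms_m take_t le_t.
set m' := g _; rewrite mem_take_revlex // => /andP[ms_m' lt_m'm] le_m'.
have [|r [lt_rs m_r m'E]] := revlex_lt_dvd _ lt_m'm le_m'; first by rewrite !ms_deg.
move=> /(gen_set_swap _ _ ms_m')[p [lt_pj m'_p k_le]].
have init_m' := congr1 (initdeg l) m'E.
rewrite !initdegD !initdegU in init_m'.
(* When x_p divides [m], it serves [m] too: r < s gives phi(m') <= phi(m). *)
have [m_p|m_p] := posnP (m p); last first.
  by apply: (exchange m p j) => //; lia.
have ps : p = s.
  apply: contraTeq m'_p => /negPf ps.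
  have := congr1 (fun m : 'X_{1..n.+1} => m p) m'E.
  rewrite !mnmDE !mnm1E m_p (eq_sym s) ps => /eqP.
  by rewrite addn_eq0 -eqn0Ngt => /andP[].
(* Now x_j m' / x_s = x_j m / x_r, so the bound on phi carries over with witness [r]. *)
subst p; apply: (exchange m r j) => //; first exact: ltn_trans lt_pj.
lia.
Qed.
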